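(* Let $X$ be a locally convex Hausdorff topological vector space, $g:X\to\overline{\mathbb R}$ a lower semicontinuous, proper, convex function, $h:X\to\overline{\mathbb R}$ a proper generalized polyhedral convex function, and $C\subset X$ a nonempty closed convex set such that $C\subset\mathrm{dom}\,g$ and $C\subset\mathrm{int}(\mathrm{dom}\,h)$. Assume that the restriction of $g$ to each line segment contained in $C$ is a continuous function. Let $\mathcal S_1$ be the local solution set of the problem of minimizing $f(x):=g(x)-h(x)$ over $x\in C$. Then every connected component of $\mathcal S_1$ is a union of finitely many convex sets, and the function $f=g-h$ has a constant value on the component.
   Context: $\overline{\mathbb R}=\mathbb R\cup\{\pm\infty\}$. $\mathrm{dom}\,\varphi=\{x\mid\varphi(x)<+\infty\}$, $\mathrm{epi}\,\varphi=\{(x,\alpha)\in X\times\mathbb R\mid x\in\mathrm{dom}\,\varphi,\ \varphi(x)\le\alpha\}$; $\varphi$ is proper if $\mathrm{dom}\,\varphi\ne\emptyset$ and $\varphi>-\infty$ everywhere; $\mathrm{int}$ denotes interior. A subset of a locally convex Hausdorff topological vector space $Z$ is generalized polyhedral convex if it has the form $\{z\in L\mid\langle z_k^*,z\rangle\le\alpha_k,\ k=1,\dots,p\}$ with $L\subset Z$ a closed affine subspace, $z_k^*\in Z^*$ (the topological dual), $\alpha_k\in\mathbb R$. A function $\varphi:X\to\overline{\mathbb R}$ is generalized polyhedral convex if $\mathrm{epi}\,\varphi$ is a generalized polyhedral convex set in $X\times\mathbb R$. $\mathcal S_1$ is the set of $\bar x\in C$ for which there is a neighborhood $U$ of $\bar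 x$ with $f(\bar x)\le f(x)$ for all $x\in C\cap U$. Connected components of $\mathcal S_1$ are its maximal connected subsets, with respect to the topology induced from $X$. *)

(* Defs.v *)
From HB Require Import structures.
From mathcomp Require Import all_boot all_order all_algebra.
From mathcomp Require Import all_classical all_reals all_analysis.

Set Implicit Arguments.
Unset Strict Implicit.
Unset Printing Implicit Defensive.

Import Order.TTheory GRing.Theory Num.Theory.
Import numFieldNormedType.Exports.

Local Open Scope classical_set_scope.
Local Open Scope ring_scope.
Local Open Scope ereal_scope.

Section ExtendedRealFunctions.
Context {R : realType} {X : tvsType R}.
Implicit Type phi : X -> \bar R.

Definition edom phi : set X := [set x | phi x < +oo].

Definition epigraph phi : set (X * R^o) :=
  [set xa | edom phi xa.1 /\ phi xa.1 <= (xa.2 : R)%:E].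

Definition proper_fun phi : Prop :=
  edom phi !=set0 /\ forall x, -oo < phi x.

(* [convex_function] of the library only covers finite-valued functions. *)
Definition convex_efun phi : Prop := convex_set (epigraph phi).

End ExtendedRealFunctions.

Section GeneralizedPolyhedral.
Context {R : realType}.

Definition affine_subspace (Z : lmodType R) (L : set Z) : Prop :=
  exists (z0 : Z) (V : {pred Z}),
    GRing.submod_closed V /\ L = [set (z0 + v)%R | v in [set` V]].

(* The topological dual of Z is made of the continuous linear maps Z -> R^o;
   p = 0 is allowed. Affine subspaces are nonempty, but the empty set is still
   generalized polyhedral convex, as {z in Z | 0 <= -1}. *)
Definition gen_polyhedral_convex_set (Z : tvsType R) (D : set Z) : Prop :=
  exists (L : set Z) (p : nat) (zstar : 'I_p -> {linear Z -> R^o})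
      (alpha : 'I_p -> R),
    [/\ affine_subspace L, closed L, forall k, continuous (zstar k) &
        D = [set z | L z /\ forall k, (zstar k z <= alpha k)%R]].

Definition gen_polyhedral_convex_fun (X : tvsType R) (phi : X -> \bar R)
  : Prop := gen_polyhedral_convex_set (epigraph phi).

End GeneralizedPolyhedral.

Definition line_segment {R : realType} {X : lmodType R} (x y : X) : set X :=
  [set (t *: x + (1 - t) *: y)%R | t in `[0%R, 1%R]%classic].

Definition local_solutions {R : realType} {X : topologicalType}
    (C : set X) (f : X -> \bar R) : set X :=
  [set x | C x /\
    exists2 U, nbhs x U & forall y, (C `&` U) y -> f x <= f y].

(* Main.v *)
Require Import Defs.
From HB Require Import structures.
From mathcomp Require Import all_boot all_order all_algebra.
From mathcomp Require Import all_classical all_reals all_analysis.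
From mathcomp Require Import ring lra.
Import Order.TTheory GRing.Theory Num.Theory.
Import numFieldNormedType.Exports.
Local Open Scope classical_set_scope.
Local Open Scope ring_scope.
Local Open Scope ereal_scope.

(** Since C lies in the interior of dom h, the domain of h has an interior
point, so epi h spans X * R: it is cut out by finitely many linear inequalities
alone. Those that involve the vertical coordinate say that, on dom h, h is the
maximum of finitely many continuous affine functions a_i
([polyhedral_max_affine]). Hence f is on C the minimum of the finitely many
convex functions g - a_i. Call i active at x when a_i x = h x.

If x is a local solution and i is active at x, then
(g - a_i) x = f x <= f y <= (g - a_i) y for y in C near x, so x minimizes the
convex function g - a_i locally, hence globally, on C. Conversely, if x
minimizes every g - a_i with i active at x, then x is a local solution: by
continuity an index that is inactive at x stays inactive near x, so around x
the value of f is always one of these g - a_i. This is [local_solutionsP].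

Convexity. Split the local solutions according to their set of active
indices. Each piece is convex: the points with a prescribed active set form a
convex set, and so do the minimizers of a convex function. A convex set is
connected, so a connected component of the local solution set is the union of
the pieces that it meets, and there are only finitely many pieces.

Constancy. Let E_i be the set of the minimizers of g - a_i on C at which i is
active. It is closed, because g is lower semicontinuous, and f is constant on
it, equal to the minimum of g - a_i. The finitely many E_i cover the local
solutions, and a function that is constant on each member of a finite closed
cover is constant on connected sets. *)

Set Implicit Arguments.
Unset Strict Implicit.
Unset Printing Implicit Defensive.

(** * Connected sets and finite covers *)

Section ConnectedSets.
Local Open Scope ring_scope.

(** A connected piece that meets a component is absorbed by it, so a component
never cuts a piece. *)
Lemma component_bigcup (T : topologicalType) (I : Type) (B : I -> set T)
    (S : set T) (x : T) :
  S = \bigcup_i B i -> (forall i, connected (B i)) ->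
  connected_component S x =
  \bigcup_(i in [set i | B i `&` connected_component S x !=set0]) B i.
Proof.
move=> SE Bc; apply/seteqP; split=> [y Ky|y [i [z [Biz Kz]] Biy]].
  have : S y by apply: connected_component_sub Ky.
  by rewrite {1}SE => -[i _ Biy]; exists i => //; exists y.
apply: (connected_component_trans Kz).
apply: (@connected_component_max _ _ (B i)) => //.
by rewrite SE => w Biw; exists i.
Qed.

(** A level set of v is, inside K, the union of the members of the cover that it
touches, and its complement is the union of the others; both are finite unions
of closed sets, so the level set is clopen in K. *)
Lemma connected_finite_closed_cover_constant (T : topologicalType) (V : Type)
    (I : finType) (F : I -> set T) (v : T -> V) (K : set T) :
  connected K -> (forall i, closed (F i)) -> K `<=` \bigcup_i F i ->
  (forall i y z, F i y -> F i z -> v y = v z) ->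
  forall y z, K y -> K z -> v y = v z.
Proof.
move=> Kc Fc KF Fv y z Ky Kz.
pose touching (Q : set T) := \bigcup_(i in [set i | F i `&` Q !=set0]) F i.
have touching_closed Q : closed (touching Q).
  by apply: closed_bigcup => //; exact: finite_finset.
have touchingP Q w : K w -> Q w -> touching Q w.
  by move=> Kw Qw; have [i _ Fw] := KF w Kw; exists i => //; exists w.
suff KE : K `&` [set w | v w = v y] = K.
  by have [_ <-] : (K `&` [set w | v w = v y]) z by rewrite KE.
apply: Kc; first by exists y.
- exists (~` touching [set w | v w <> v y]).
    exact/closed_openC/touching_closed.
  apply/seteqP; split=> w [Kw /= vw]; split=> //.
    by case=> i [u [Fu /= vu]] Fw; apply: vu; rewrite -vw; exact: Fv Fu Fw.
  by apply: contrapT => nvw; apply: vw; exact: touchingP.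
- exists (touching [set w | v w = v y]); first exact: touching_closed.
  apply/seteqP; split=> w [Kw /= vw]; split=> //; first exact: touchingP.
  by case: vw => i [u [Fu /= vu]] Fw; rewrite -vu; exact: Fv Fw Fu.
Qed.

End ConnectedSets.

(** * Convex sets *)

Section ConvexSets.
Local Open Scope ring_scope.

(** Trades the bundled weights of [convex_set] for real numbers, and its boolean
memberships for propositions. *)
Lemma convex_setP (R : realType) (M : lmodType R) (A : set M) :
  convex_set A <->
  forall x y (t : R), A x -> A y -> 0 <= t <= 1 ->
    A (t *: x + (1 - t) *: y).
Proof.
split=> [Ac x y t Ax Ay t01|Ac x y l].
  have := Ac x y (Itv01 (andP t01).1 (andP t01).2).
  by rewrite !inE; apply.
rewrite !inE => Ax Ay; apply: Ac => //.
by apply/andP; split.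
Qed.

Context {R : realType} {X : tvsType R}.

Lemma segment_continuous (x y : X) :
  continuous (fun t : R => t *: x + (1 - t) *: y).
Proof.
have scl (z : X) : continuous (fun t : R => t *: z).
  move=> t; apply: (@continuous_comp R (R^o * X)%type X
    (fun t : R => (t : R^o, z)) (fun w : R^o * X => w.1 *: w.2)).
    apply: (@cvg_pair _ _ _ _ (nbhs (t : R^o)) (nbhs z)); first exact: cvg_id.
    exact: cvg_cst.
  exact: scale_continuous.
move=> t; apply: (@continuous_comp _ _ _ (fun t : R => (t *: x, (1 - t) *: y))
  (fun z : X * X => z.1 + z.2)); last exact: add_continuous.
apply: (@cvg_pair _ _ _ _ (nbhs (t *: x)) (nbhs ((1 - t) *: y))).
  exact: scl.
apply: (@continuous_comp R R X (fun t => 1 - t) (fun t => t *: y)).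
  by apply: cvgB; [exact: cvg_cst|exact: cvg_id].
exact: scl.
Qed.

Lemma segment_enters_nbhs (x y : X) (U : set X) : nbhs x U ->
  exists2 t : R, 0 < t <= 1 & U (t *: y + (1 - t) *: x).
Proof.
move=> Ux; have segU : \forall t \near (0 : R), U (t *: y + (1 - t) *: x).
  have := @segment_continuous y x 0.
  rewrite /continuous_at scale0r add0r subr0 scale1r; exact.
near (0 : R)^'+ => t; exists t.
  by apply/andP; split=> //; near: t; exact: nbhs_right_le.
near: t; exact: cvg_within segU.
Unshelve. all: by end_near. Qed.

(** A convex set is the union of the segments joining one of its points to the
others. *)
Lemma convex_set_connected (A : set X) : convex_set A -> connected A.
Proof.
move=> /convex_setP Ac.
have [->|/set0P[x Ax]] := eqVneq A set0; first exact: connected0.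
pose seg y := (fun t : R => t *: x + (1 - t) *: y) @` `[0, 1].
have -> : A = \bigcup_(y in A) seg y.
  apply/seteqP; split=> [y Ay|z [y Ay [t]]].
    exists y => //; exists 0; first by rewrite /= in_itv /= lexx ler01.
    by rewrite scale0r add0r subr0 scale1r.
  by rewrite /= in_itv /= => t01 <-; exact: Ac.
apply: bigcup_connected => [|y Ay].
  exists x => y Ay; exists 1; first by rewrite /= in_itv /= lexx ler01.
  by rewrite scale1r subrr scale0r addr0.
apply: connected_continuous_connected; first exact: segment_connected.
exact/continuous_subspaceT/segment_continuous.
Qed.

End ConvexSets.

(** * Minimizers of convex functions *)

Section Minimizers.
Local Open Scope ring_scope.
Context {R : realType} {X : tvsType R}.
Implicit Types (C : set X) (phi : X -> R).

(** The convexity of [convex_function], with plain real weights. *)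
Definition convex_on C phi := forall x y (t : R), C x -> C y -> 0 <= t <= 1 ->
  phi (t *: x + (1 - t) *: y) <= t * phi x + (1 - t) * phi y.

Definition minimizers C phi : set X :=
  [set x | C x /\ forall y, C y -> phi x <= phi y].

(** Move from x a little towards a competitor y, staying in U: convexity carries
the inequality phi x <= phi obtained there over to y. *)
Lemma local_minimizer_global C phi (x : X) (U : set X) :
  convex_set C -> convex_on C phi -> C x -> nbhs x U ->
  (forall y, C y -> U y -> phi x <= phi y) -> minimizers C phi x.
Proof.
move=> /convex_setP Cc phic Cx Ux xmin; split=> // y Cy.
have [t /andP[t0 t1] Ut] := segment_enters_nbhs y Ux.
have := phic y x t Cy Cx; rewrite (ltW t0) t1 => /(_ isT) phile.
have CUt : C (t *: y + (1 - t) *: x) by apply: Cc; rewrite ?(ltW t0).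
have := le_trans (xmin _ CUt Ut) phile.
by rewrite mulrBl mul1r addrCA lerDl -mulrBr pmulr_rge0 // subr_ge0.
Qed.

Lemma minimizers_convex C phi :
  convex_set C -> convex_on C phi -> convex_set (minimizers C phi).
Proof.
move=> /convex_setP Cc phic; apply/convex_setP => x y t [Cx mx] [Cy my] t01.
split=> [|z Cz]; first exact: Cc.
apply: le_trans (phic _ _ _ Cx Cy t01) _.
have := mx z Cz; have := my z Cz; move: t01 => /andP[t0 t1].
by nra.
Qed.

(** If there is a minimizer z, the minimizers form the sublevel set of phi at
phi z. *)
Lemma minimizers_closed C phi :
  (forall c : R, closed (C `&` [set y | phi y <= c])) ->
  closed (minimizers C phi).
Proof.
move=> cl.
have [[z mz]|nz] := pselect (minimizers C phi !=set0).
  have -> : minimizers C phi = C `&` [set y | phi y <= phi z].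
    apply/seteqP; split=> y [Cy /= my]; split=> //; first exact/my/mz.1.
    by move=> w Cw; apply: le_trans my _; exact: mz.2.
  exact: cl.
have -> : minimizers C phi = set0.
  by apply/seteqP; split=> // y my; case: nz; exists y.
exact: closed0.
Qed.

End Minimizers.

(** * A convex function minus a maximum of affine functions *)

Section MaxAffine.
Local Open Scope ring_scope.
Context {R : realType} {X : tvsType R}.
Implicit Types (C : set X) (a : X -> R).

Definition affine_fun a := forall x y (t : R),
  a (t *: x + (1 - t) *: y) = t * a x + (1 - t) * a y.

Variables (I : finType) (a : I -> X -> R) (C : set X) (G H : X -> R).

Definition active (x : X) : {set I} := [set i | a i x == H x]%SET.

Hypothesis C_convex : convex_set C.
Hypothesis G_convex : convex_on C G.
Hypothesis G_sub_closed : forall i c,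
  closed (C `&` [set x | G x - a i x <= c]).
Hypothesis a_affine : forall i, affine_fun (a i).
Hypothesis a_cont : forall i, continuous (a i).
Hypothesis C_closed : closed C.
Hypothesis H_ge : forall x, C x -> forall i, a i x <= H x.
Hypothesis H_attained : forall x, C x -> exists i, i \in active x.

Let F := fun x => G x - H x.
Let Fi i := fun x => G x - a i x.
Let S := local_solutions C (fun x => (F x)%:E).

Lemma sub_affine_convex i : convex_on C (Fi i).
Proof.
move=> x y t Cx Cy t01; rewrite /Fi (a_affine i).
by have := G_convex Cx Cy t01; nra.
Qed.

Lemma active_eq x i : i \in active x -> H x = a i x.
Proof. by rewrite inE => /eqP. Qed.

(** Passing to a nearby point can only shrink the active set: a strict
inequality between two of the continuous functions a i persists. *)
Lemma active_nbhs x : C x ->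
  \forall y \near x, C y -> active y \subset active x.
Proof.
move=> Cx.
have [j jx] := H_attained Cx.
have lt i : i \notin active x -> \forall y \near x, a i y < a j y.
  move=> ix; have : 0 < a j x - a i x.
    rewrite -(active_eq jx) subr_gt0 lt_neqAle H_ge // andbT.
    by rewrite inE in ix.
  have /cvgr_gt : continuous_at x (fun y => a j y - a i y : R^o).
    by apply: cvgB; exact: a_cont.
  move=> /(_ 0) /[apply]; apply: filterS => y.
  by rewrite subr_gt0.
have : \forall y \near x, forall i, i \notin active x -> a i y < a j y.
  apply: filter_forall => i; have [ix|ix] := boolP (i \in active x).
    exact: nearW.
  by apply: filterS (lt i ix).
apply: filterS => y ylt Cy; apply/fintype.subsetP => i iy.
apply/negPn/negP => ix.
by have := lt_le_trans (ylt i ix) (H_ge Cy j); rewrite (active_eq iy) ltxx.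
Qed.

(** On C, the function F lies below G - a i, with equality at x when i is active
at x; so a local solution x minimizes G - a i locally, hence globally.
Conversely, near x each value of F on C is a value of G - a i for some i that is
active at x, by [active_nbhs]. *)
Lemma local_solutionsP x : S x <->
  C x /\ forall i, i \in active x -> minimizers C (Fi i) x.
Proof.
split=> [[Cx [U Ux xmin]]|[Cx xmin]].
  split=> // i ix; apply: (local_minimizer_global (U := U)) => //.
    exact: sub_affine_convex.
  move=> y Cy Uy; have := xmin y (conj Cy Uy).
  rewrite lee_fin /F /Fi (active_eq ix) => /le_trans; apply.
  by rewrite lerB // H_ge.
split=> //; exists [set y | C y -> active y \subset active x].
  exact: active_nbhs.
move=> y [Cy yx0]; have /fintype.subsetP yx := yx0 Cy; rewrite lee_fin.
have [i iy] := H_attained Cy.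
have ix := yx i iy.
by rewrite /F (active_eq iy) (active_eq ix); exact: (xmin i ix).2.
Qed.

Let piece (J : {set I}) : set X :=
  [set x | C x /\ active x = J /\ forall i, i \in J -> minimizers C (Fi i) x].

(** On the segment, the gap between an index that is active at both ends and
another index i is the convex combination of the gaps of i at the ends. It is
zero when i is active at both ends, and positive when it is active at
neither. *)
Lemma active_segment x y t : C x -> C y -> 0 <= t <= 1 ->
  active x = active y -> active (t *: x + (1 - t) *: y) = active x.
Proof.
move=> Cx Cy t01 xy; set z := t *: x + _.
have Cz : C z by move/convex_setP : C_convex; apply.
have [j jx] := H_attained Cx.
have jy : j \in active y by rewrite -xy.
have az i : a i z = t * a i x + (1 - t) * a i y by exact: a_affine.
have gap i : a j z - a i z = t * (H x - a i x) + (1 - t) * (H y - a i y).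
  by rewrite !az (active_eq jx) (active_eq jy); ring.
move: (t01) => /andP[t0 t1].
have ge i : a i z <= a j z.
  rewrite -subr_ge0 gap addr_ge0 ?mulr_ge0 ?subr_ge0 //; exact: H_ge.
have Hz : H z = a j z.
  have [k kz] := H_attained Cz.
  by apply/le_anti; rewrite H_ge // (active_eq kz) ge.
apply/setP => i.
rewrite [LHS]inE Hz eq_sym -subr_eq0 gap.
have [ix|ix] := boolP (i \in active x).
  have iy : i \in active y by rewrite -xy.
  by rewrite (active_eq ix) (active_eq iy) !subrr !mulr0 addr0 eqxx.
have iy : i \notin active y by rewrite -xy.
have lt w : C w -> i \notin active w -> 0 < H w - a i w.
  by move=> Cw iw; rewrite subr_gt0 lt_neqAle H_ge // andbT; rewrite inE in iw.
apply/negbTE/lt0r_neq0; have := lt _ Cx ix; have := lt _ Cy iy.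
have [->|tn0] := eqVneq t 0; first by rewrite mul0r add0r subr0 mul1r.
move=> Hy Hx; rewrite ltr_wpDr //; first by rewrite mulr_ge0 ?subr_ge0 ?H_ge.
by rewrite mulr_gt0 // lt_neqAle eq_sym tn0.
Qed.

Lemma piece_convex J : convex_set (piece J).
Proof.
apply/convex_setP => x y t [Cx [xJ xmin]] [Cy [yJ ymin]] t01.
split; first by move/convex_setP : C_convex; apply.
split; first by rewrite active_segment // xJ.
move=> i iJ.
have /convex_setP := minimizers_convex C_convex (@sub_affine_convex i).
by apply => //; [exact: xmin|exact: ymin].
Qed.

Lemma local_solutions_bigcup : S = \bigcup_J piece J.
Proof.
apply/seteqP; split=> [x /local_solutionsP[Cx xmin]|x [J _ [Cx [<- xmin]]]].
  by exists (active x).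
exact/local_solutionsP.
Qed.

Lemma component_local_solutions_convex x :
  exists (n : nat) (A : 'I_n -> set X), (forall i, convex_set (A i)) /\
    connected_component S x = \bigcup_i A i.
Proof.
have := component_bigcup x local_solutions_bigcup
  (fun J => convex_set_connected (@piece_convex J)).
set P := [set J | _] => ->.
(* Pieces that miss the component are replaced by the empty set. *)
exists #|{set I}|, (fun k => [set y | P (enum_val k) /\ piece (enum_val k) y]).
split=> [k|].
  apply/convex_setP => y z t [Pk ky] [_ kz] t01; split=> //.
  by have /convex_setP := @piece_convex (enum_val k); apply.
apply/seteqP; split=> [y [J PJ Jy]|y [k _ [Pk ky]]].
  by exists (enum_rank J) => //=; rewrite enum_rankK.
by exists (enum_val k).
Qed.

(** The cover is made of the sets E i of minimizers of G - a i at which i is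
active. Unlike the pieces above, they are closed, since they allow further
indices to be active. *)
Lemma component_local_solutions_constant x :
  forall y, connected_component S x y -> F y = F x.
Proof.
pose E i := C `&` [set y | H y = a i y] `&` minimizers C (Fi i).
have [Sx|nSx] := pselect (S x); last first.
  by rewrite (connected_component_out nSx).
move=> y Ky.
apply: (@connected_finite_closed_cover_constant _ _ I E F
  (connected_component S x)) => //.
- exact: component_connected.
- move=> i; apply: closedI; last first.
    exact/minimizers_closed/G_sub_closed.
  have -> : C `&` [set y | H y = a i y] =
      C `&` \bigcap_j [set y | a j y - a i y <= 0].
    apply/seteqP; split=> z [Cz /= zi]; split=> //.
      by move=> j _ /=; rewrite subr_le0 -zi H_ge.
    have [j jz] := H_attained Cz.
    apply/le_anti; rewrite /= H_ge // andbT (active_eq jz) -subr_le0.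
    exact: zi.
  apply: closedI => //; apply: closed_bigI => j _.
  apply: (@preimage_closed _ _ (fun y => a j y - a i y) [set r | r <= 0]).
    by move=> z _; apply: (@cvgB R R^o); exact: a_cont.
  exact: closed_le.
- move=> z /connected_component_sub /local_solutionsP[Cz zmin].
  have [i iz] := H_attained Cz; exists i => //; split; last exact: zmin.
  by split=> //; exact: active_eq.
- move=> i z w [[Cz zi] [_ zmin]] [[Cw wi] [_ wmin]].
  by rewrite /F zi wi; apply/le_anti/andP; split; [exact: zmin|exact: wmin].
- exact: connected_component_refl.
Qed.

End MaxAffine.

(** * Finite values of proper functions *)

Section ProperConvexLsc.
Local Open Scope ring_scope.
Context {R : realType} {X : tvsType R}.
Variables (C : set X) (g : X -> \bar R).
Hypothesis C_dom : C `<=` edom g.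
Hypothesis g_proper : proper_fun g.

Lemma fin_on_domain x : edom g x -> g x \is a fin_num.
Proof. by move=> gx; rewrite fin_numElt g_proper.2. Qed.

Lemma fine_convex_on : convex_efun g -> convex_on C (fun x => fine (g x)).
Proof.
move=> /convex_setP gc x y t Cx Cy t01.
have epi w : C w -> epigraph g (w, fine (g w)).
  move=> Cw; split; first exact: C_dom.
  by rewrite /= fineK // fin_on_domain //; exact: C_dom.
have [/= domz] := gc _ _ t (epi x Cx) (epi y Cy) t01.
by rewrite /= -lee_fin (fineK (fin_on_domain domz)).
Qed.

Lemma lsc_sublevel_closed : closed C -> lower_semicontinuous g ->
  forall (b : X -> R) (c : R), continuous b ->
  closed (C `&` [set x | fine (g x) - b x <= c]).
Proof.
move=> C_closed g_lsc b c b_cont.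
move=> x clx; have Cx : C x.
  by apply: C_closed; apply: closureS clx; exact: subIsetl.
split=> //=; rewrite leNgt; apply/negP => cx.
(* r separates c + b from g near x. *)
pose r := (c + b x + fine (g x)) / 2.
have [V Vx Vg] : exists2 V, nbhs x V & forall y, V y -> (r%:E < g y)%E.
  apply: g_lsc; rewrite -(fineK (fin_on_domain (C_dom Cx))) lte_fin /r.
  by lra.
have bx : \forall y \near x, b y < r - c.
  by apply: (cvgr_lt (b x) (b_cont x)); rewrite /r; lra.
have [y [[Cy /= gy] [Vy yr]]] := clx _ (filterI Vx bx).
have := Vg y Vy; rewrite -(fineK (fin_on_domain (C_dom Cy))) lte_fin.
by move: yr => /=; lra.
Qed.

End ProperConvexLsc.

(** * Generalized polyhedral functions as maxima of affine functions *)

Section Polyhedral.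
Local Open Scope ring_scope.
Context {R : realType} {X : tvsType R}.
Variable h : X -> \bar R.
Hypothesis h_proper : proper_fun h.

Lemma epigraphP x (s : R) : edom h x -> epigraph h (x, s) <-> fine (h x) <= s.
Proof.
move=> hx; rewrite /epigraph /= -lee_fin (fineK (fin_on_domain h_proper hx)).
by split=> [[]|].
Qed.

(** With c interior to dom h, the direction space V of L contains the vertical
direction, because epi h is stable upwards, and a vector above t *: v for each v
in X and some t > 0, because c + t *: v is in dom h; these span X * R. *)
Lemma affine_hull_epigraph (L : set (X * R^o)) :
  interior (edom h) !=set0 -> affine_subspace L -> epigraph h `<=` L ->
  L = setT.
Proof.
move=> [c cint] [z0 [V [[V0 Vlin] ->]]] hL.
have ch := interior_subset cint.
have VB (u w : X * R^o) : epigraph h u -> epigraph h w -> u - w \in V.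
  move=> /hL[u' Vu <-] /hL[w' Vw <-].
  have -> : z0 + u' - (z0 + w') = (-1) *: w' + u'.
    by rewrite scaleN1r opprD addrACA subrr add0r addrC.
  exact: Vlin.
have vertical : ((0, 1) : X * R^o) \in V.
  have := VB (c, fine (h c) + 1) (c, fine (h c)).
  have -> : ((c, fine (h c) + 1) : X * R^o) - (c, fine (h c)) = (0, 1).
    by congr (_, _); rewrite /= ?subrr // addrAC subrr add0r.
  by apply; apply/epigraphP; rewrite // lerDl.
suff VT (z : X * R^o) : z \in V.
  rewrite -subTset => z _; exists (z - z0); first exact: VT.
  by rewrite addrC subrK.
have [t /andP[t0 _] dt] := segment_enters_nbhs (c + z.1) cint.
move: dt; have -> : t *: (c + z.1) + (1 - t) *: c = c + t *: z.1.
  by rewrite scalerDr scalerBl scale1r addrAC [t *: c + _]addrCA subrr addr0.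
set d := c + _ => dt.
(* z as the scaled difference of the epigraph points above d and c, corrected
   vertically. *)
have -> : z = t^-1 *: ((d, fine (h d)) - (c, fine (h c)) : X * R^o) +
    ((z.2 - t^-1 * (fine (h d) - fine (h c))) *: ((0, 1) : X * R^o) + 0).
  rewrite addr0; case: z @d dt => v s /= dt.
  congr (_, _) => /=.
    by rewrite scaler0 addr0 addrC addKr scalerA mulVf ?lt0r_neq0 // scale1r.
  by rewrite [X in _ + X]mulr1 addrC subrK.
apply: (Vlin); last exact: Vlin.
by apply: VB; apply/epigraphP.
Qed.

(** Write the k-th inequality as l k (x, 0) + s * b k <= al k. As epi h is
stable upwards, b k <= 0. If b k = 0 the inequality restricts x only, and it
holds on dom h. If b k < 0, it says that s is at least the affine function
(al k - l k (x, 0)) / b k. Such indices exist, since otherwise h would be -oo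
on its domain. *)
Lemma polyhedral_max_affine :
  gen_polyhedral_convex_fun h -> interior (edom h) !=set0 ->
  exists (I : finType) (a : I -> X -> R),
    [/\ forall i, affine_fun (a i), forall i, continuous (a i) &
        forall x, edom h x -> (forall i, a i x <= fine (h x)) /\
                              exists i, fine (h x) = a i x].
Proof.
move=> [L [p [l [al [Laff _ lc epiE]]]]] hint.
have LT : L = setT.
  by apply: (affine_hull_epigraph hint Laff) => z; rewrite epiE => -[].
pose b k := l k (0, 1).
have epi_l x s : epigraph h (x, s) <-> forall k, l k (x, 0) + s * b k <= al k.
  have lE k : l k (x, 0) + s * b k = l k (x, s).
    have -> : ((x, s) : X * R^o) = s *: ((0, 1) : X * R^o) + (x, 0).
      by congr (_, _); rewrite /= ?scaler0 ?add0r // addr0 [RHS]mulr1.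
    by rewrite linearP addrC.
  rewrite epiE LT; split=> [[_ kz] k|kz]; first by rewrite lE.
  by split=> // k; rewrite -lE.
have b_le0 k : b k <= 0.
  have [c /interior_subset ch] := hint.
  rewrite leNgt; apply/negP => bk.
  have /epi_l/(_ k) : epigraph h (c, fine (h c)) by apply/epigraphP.
  (* Raising the point by t overshoots the bound al k by b k. *)
  pose t := (al k - (l k (c, 0) + fine (h c) * b k)) / b k + 1.
  move=> lk; have t0 : 0 <= t by rewrite addr_ge0 // divr_ge0 ?subr_ge0 // ltW.
  have /epi_l/(_ k) : epigraph h (c, fine (h c) + t).
    by apply/epigraphP; rewrite // lerDl.
  rewrite mulrDl addrA /t mulrDl mulfVK ?lt0r_neq0 //.
  by move: bk => /=; lra.
pose a (i : {k | b k < 0}) x := (al (val i) - l (val i) (x, 0)) / b (val i).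
have aP i x s : a i x <= s <-> l (val i) (x, 0) + s * b (val i) <= al (val i).
  by rewrite /a ler_ndivrMr ?(valP i) // lerBrDl.
exists {k | b k < 0}, a; split.
- move=> i x y t; rewrite /a.
  have -> : ((t *: x + (1 - t) *: y, 0) : X * R^o) =
      t *: ((x, 0) : X * R^o) + (1 - t) *: ((y, 0) : X * R^o).
    by congr (_, _); rewrite /= !scaler0 addr0.
  rewrite linearD !linearZ /= /GRing.scale /=.
  by ring.
- move=> i x.
  have li : {for x, continuous (fun x => l (val i) (x, 0) : R)}.
    apply: (@continuous_comp X (X * R^o)%type R (fun x => (x, 0)) (l (val i))).
      apply: (@cvg_pair _ _ _ _ (nbhs x) (nbhs (0 : R^o))); first exact: cvg_id.
      exact: cvg_cst.
    exact: lc.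
  by apply: cvgM; [apply: cvgB; [exact: cvg_cst|exact: li]|exact: cvg_cst].
move=> x hx.
have a_le i : a i x <= fine (h x).
  by apply/aP; move: (val i); apply/epi_l/epigraphP.
have le_bound s : (forall i, a i x <= s) -> fine (h x) <= s.
  move=> a_s; apply/epigraphP => //; apply/epi_l => k.
  have := b_le0 k; rewrite le_eqVlt => /predU1P[bk|bk].
    have /epi_l/(_ k) : epigraph h (x, fine (h x)) by apply/epigraphP.
    by rewrite bk !mulr0.
  exact/(aP (exist _ k bk)).
split=> //.
have [i0 _|noI] := pickP {: {k | b k < 0}}; last first.
  suff : fine (h x) <= fine (h x) - 1 by rewrite lerBrDl gerDr ler10.
  by apply: le_bound => i; have := noI i.
case: (@Order.TotalTheory.arg_maxP _ _ _ i0 xpredT (fun i => a i x)) => //.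
move=> i _ imax.
exists i; apply/le_anti; rewrite a_le andbT le_bound // => j.
exact: imax.
Qed.

End Polyhedral.

Theorem theorem4p5 (R : realType) (X : tvsType R) (hX : hausdorff_space X)
    (g h : X -> \bar R) (C : set X)
    (g_lsc : lower_semicontinuous g)
    (g_proper : proper_fun g)
    (g_convex : convex_efun g)
    (h_proper : proper_fun h)
    (h_gpc : gen_polyhedral_convex_fun h)
    (C_nonempty : C !=set0)
    (C_closed : closed C)
    (C_convex : convex_set C)
    (C_dom_g : C `<=` edom g)
    (C_int_dom_h : C `<=` interior (edom h))
    (g_segment : forall x y : X, line_segment x y `<=` C ->
      {within line_segment x y, continuous g})
    (f := fun x => g x - h x)
    (S1 := local_solutions C f) :
  forall x : X, S1 x ->
    (exists (n : nat) (A : 'I_n -> set X),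
       (forall i, convex_set (A i)) /\
       connected_component S1 x = \bigcup_i A i) /\
    (exists c : R, forall y, connected_component S1 x y -> f y = c%:E).
Proof.
have C_dom_h : C `<=` edom h by move=> y /C_int_dom_h; exact: interior_subset.
have [I [a [a_aff a_cont h_max]]] : exists (I : finType) (a : I -> X -> R),
    [/\ forall i, affine_fun (a i), forall i, continuous (a i) &
        forall x, edom h x -> (forall i, a i x <= fine (h x))%R /\
                              exists i, fine (h x) = a i x].
  apply: polyhedral_max_affine => //.
  by case: C_nonempty => y Cy; exists y; exact: C_int_dom_h.
pose G y := fine (g y); pose H y := fine (h y); pose F y := (G y - H y)%R.
have fE y : C y -> f y = (F y)%:E.
  move=> Cy; rewrite /f -(fineK (fin_on_domain g_proper (C_dom_g _ Cy))).
  by rewrite -(fineK (fin_on_domain h_proper (C_dom_h _ Cy))).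
have S1E : S1 = local_solutions C (fun y => (F y)%:E).
  apply/seteqP; split=> x [Cx [U Ux xmin]]; split=> //; exists U => // y CUy;
    by have := xmin y CUy; rewrite !fE //; case: CUy.
have G_conv := fine_convex_on C_dom_g g_proper g_convex.
have G_cl i (c : R) : closed (C `&` [set y | (G y - a i y <= c)%R]).
  by apply: lsc_sublevel_closed; last exact: a_cont.
have H_ge y : C y -> forall i, (a i y <= H y)%R.
  by move=> Cy; exact: (h_max y (C_dom_h y Cy)).1.
have H_att y : C y -> exists i, i \in active a H y.
  move=> Cy; have [_ [i iy]] := h_max y (C_dom_h y Cy); exists i.
  by rewrite inE /H iy.
move=> x S1x; split.
  rewrite S1E.
  exact: (component_local_solutions_convex (G := G) (H := H) C_convex G_conv
    a_aff a_cont H_ge H_att).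
exists (F x) => y Ky.
rewrite fE; last by have [] := connected_component_sub Ky.
congr (_%:E); move: Ky; rewrite S1E => Ky.
exact: (component_local_solutions_constant (G := G) (H := H) C_convex G_conv
  G_cl a_aff a_cont C_closed H_ge H_att Ky).
Qed.
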